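(* There are an infinite set $\mathcal N$ of positive integers and, for each $n\in\mathcal N$, a total Boolean function $G_n:\{0,1\}^{N_n}\to\{0,1\}$, where $N_n=\widetilde{\Theta}(n^3)$, such that, as $n\to\infty$ in $\mathcal N$, \[ \mathrm{C}(G_n)=\Omega(n^2)\qquad\text{and}\qquad \widetilde{\deg}(G_n)=\widetilde{\Theta}(\sqrt n), \] and hence \[ \mathrm{C}(G_n)=\widetilde{\Omega}\bigl(\widetilde{\deg}(G_n)^4\bigr). \]
   Context: A partial assignment is a string $\rho\in\{0,1,*\}^N$; its size $|\rho|$ is the number of indices $i$ with $\rho_i\neq *$; an input $x\in\{0,1\}^N$ is consistent with $\rho$ (is a completion of $\rho$) if $\rho_i=x_i$ whenever $\rho_i\ne *$. For a total Boolean function $g:\{0,1\}^N\to\{0,1\}$ and $x$ with $g(x)=b$, a $b$-certificate for $x$ is a partial assignment $\rho$ consistent with $x$ such that $g(x')=b$ for every completion $x'$ of $\rho$. The certificate complexity $\mathrm{C}(g)$ is the maximum over inputs $x$ of the minimum size of a $g(x)$-certificate for $x$. The approximate degree $\widetilde{\deg}(g)$ is the least degree of a real polynomial $p$ in $N$ variables with $|p(x)-g(x)|\le 1/3$ for all $x\in\{0,1\}^N$. $\widetilde{O},\widetilde{\Omega},\widetilde{\Theta}$ suppress factors polylogarithmic in the asymptotic parameter $n$: e.g. $a_n=\widetilde{\Omega}(b_n)$ means that there are constants $c,e>0$ with $a_n\ge c\,b_n/(\log n)^{e}$ for all sufficiently large $n$ (in $\mathcal N$). *)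

(* Defs.v *)
From HB Require Import structures.
From mathcomp Require Import all_boot all_order all_algebra.
From mathcomp Require Import boolp reals.
From mathcomp Require mpoly.

Set Implicit Arguments.
Unset Strict Implicit.
Unset Printing Implicit Defensive.

Import Order.TTheory GRing.Theory Num.Theory.

Notation bits N := {ffun 'I_N -> bool}.

Notation boolfun N := (bits N -> bool).

(* None stands for the star symbol. *)
Notation partial_assignment N := {ffun 'I_N -> option bool}.

Section CertificateComplexity.
Variable N : nat.
Implicit Types (g : boolfun N) (x : bits N) (rho : partial_assignment N).

Definition pa_size rho : nat := #|[set i | rho i != None]|.

Definition consistent rho x : bool :=
  [forall i, (rho i != None) ==> (rho i == Some (x i))].

Definition certificate g x rho : bool :=
  consistent rho x && [forall x', consistent rho x' ==> (g x' == g x)].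

Definition total_assignment x : partial_assignment N := [ffun i => Some (x i)].

Lemma total_assignment_certificate g x : certificate g x (total_assignment x).
Proof.
apply/andP; split; first by apply/forallP => i; rewrite ffunE eqxx implybT.
apply/forallP => x'; apply/implyP => /forallP xx'.
suff -> : x' = x by [].
by apply/ffunP => i; have /implyP := xx' i; rewrite ffunE => /(_ isT)/eqP[].
Qed.

Definition cert_size g x : nat :=
  pa_size [arg min_(rho < total_assignment x | certificate g x rho) pa_size rho].

Definition cert_complexity g : nat := \max_(x : bits N) cert_size g x.

End CertificateComplexity.

(* mpoly is imported only inside this section, because its notations clash with
   those of the topology and analysis files imported below. *)
Section ApproximateDegree.
Import mpoly.
Local Open Scope ring_scope.
Variables (R : realType) (N : nat).
Implicit Types (g : boolfun N) (p : {mpoly R[N]}).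

(* msize is one more than the total degree, except that msize 0 = 0; the zero
   polynomial thus gets degree 0. *)
Definition mpoly_degree p : nat := (msize p).-1.

Definition approximates p g : Prop :=
  forall x : bits N, `|p.@[fun i => (x i)%:R] - (g x)%:R| <= 3^-1.

Definition approximable_in_degree g (d : nat) : Prop :=
  exists2 p, mpoly_degree p = d & approximates p g.

Lemma approximable g : exists d, `[< approximable_in_degree g d >].
Proof.
pose mono (y : bits N) : {mpoly R[N]} :=
  \prod_(i < N) (if y i then 'X_i else 1 - 'X_i).
have monoE (x y : bits N) :
    (mono y).@[fun i => (x i)%:R] = (x == y)%:R.
  rewrite rmorph_prod /=; have [<-|neq_xy] := eqVneq x y.
    rewrite big1 // => i _; case: ifP => xi; rewrite ?mevalB ?meval1 mevalXU xi //.
    by rewrite subr0.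
  have [i neq_xyi] : exists i, x i != y i.
    by apply/existsP; apply: contraNT neq_xy => /existsPn xy;
       apply/eqP/ffunP => i; apply/eqP; have /negPn := xy i.
  rewrite (bigD1 i) //=.
  case: (y i) neq_xyi; rewrite ?mevalB ?meval1 mevalXU; case: (x i) => // _.
  - by rewrite mulr0n mul0r.
  - by rewrite mulr1n subrr mul0r.
pose p : {mpoly R[N]} := \sum_(y : bits N) (g y)%:R *: mono y.
exists (mpoly_degree p); apply/asboolP; exists p => // x.
have -> : p.@[fun i => (x i)%:R] = (g x)%:R.
  rewrite raddf_sum (bigD1 x) //= mevalZ monoE eqxx mulr1 big1 ?addr0 // => y.
  by rewrite mevalZ monoE eq_sym => /negPf ->; rewrite mulr0.
by rewrite subrr normr0 invr_ge0 ler0n.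
Qed.

Definition approx_degree g : nat := ex_minn (approximable g).

End ApproximateDegree.

Arguments approx_degree R {N} g.

From mathcomp Require Import classical_sets cardinality topology normedtype.
From mathcomp Require Import landau sequences exp.
Import numFieldNormedType.Exports.

Local Open Scope classical_set_scope.
Local Open Scope ring_scope.

(* Used for nonnegative sequences a and b.  The statement takes F to be
   "within NN \oo", that is, n tends to infinity in NN. *)
Section SoftAsymptotics.
Variables (R : realType) (F : set_system nat).
Implicit Types a b : nat -> R.

Definition soft_Omega a b : Prop :=
  exists c e : R, [/\ 0 < c, 0 < e &
    \forall n \near F, c * b n / (ln n%:R) `^ e <= a n].

Definition soft_O a b : Prop :=
  exists c e : R, [/\ 0 < c, 0 < e &
    \forall n \near F, a n <= c * b n * (ln n%:R) `^ e].

Definition soft_Theta a b : Prop := soft_O a b /\ soft_Omega a b.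

End SoftAsymptotics.

(* Main.v *)
(* The construction is a cheat-sheet function built on binary trees with n^2 leaves.
   Every tree node carries a block of n bits.  A tree has value 1 if some
   root-to-leaf path is all ones, and value 0 if some cut of at most n nodes has a
   zero in each of its blocks; these two certificates have about n bits and exclude
   each other.  Take blocks all 0 at the leaves and all 1 elsewhere: fewer than n^2
   known bits leave some leaf block untouched, so they do not exclude value 1, and
   they fill fewer than n internal blocks, so splitting the filled nodes yields a
   cut of at most n nodes and they do not exclude value 0 either.

   The function G has k = log n^2 trees and, for each label l in {0,1}^k, a sheet of
   pointers; G = 1 iff for some l the sheet points to certificates that the trees
   have values l_1, ..., l_k.  Since at most one sheet is valid, G is the sum over l
   of the validity predicates.  Each is a conjunction of about n log^2 n tests of
   polylogarithmic degree, so it has approximate degree about sqrt n even with error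
   1 / n^2.  On the other hand a 0-certificate of the input above must touch each of
   the n^2 sheets or spend n^2 bits on one tree, and G restricts to an AND of n bits. *)
Require Import Defs.
From HB Require Import structures.
From mathcomp Require Import all_boot all_order all_algebra.
From mathcomp Require Import boolp reals.
From mathcomp Require Import zify ring lra.
From mathcomp Require mpoly.
Set Implicit Arguments.
Unset Strict Implicit.
Unset Printing Implicit Defensive.
Import Order.TTheory GRing.Theory Num.Theory.

(** * The function and its certificate complexity *)

Lemma exists_notin_imset (S A : finType) (h : S -> A) (T : {set S}) :
  #|T| < #|A| -> exists a, forall t, t \in T -> h t != a.
Proof.
move=> TA; have : [exists a, a \notin h @: T].
  apply: contraLR TA => /existsPn hT; rewrite -leqNgt.
  apply: leq_trans (leq_imset_card h _); rewrite -cardsT; apply/subset_leq_card/subsetP.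
  by move=> a _; have /negPn := hT a.
by case/existsP=> a aT; exists a => t tT; apply: contraNneq aT => <-; apply: imset_f.
Qed.

Section Construction.
Variables k n' b : nat.
Local Notation n := n'.+1.

(* ((d, m), c) is the c-th bit of the block of the tree node at height d with
   leaf interval [m 2^d, (m+1) 2^d); indices m with (m+1) 2^d > 2^k are junk. *)
Definition cell := ('I_k.+1 * 'I_(2 ^ k) * 'I_n)%type.
Implicit Types v w : cell.

Definition height v : nat := v.1.1.
Definition lo v := v.1.2 * 2 ^ v.1.1.
Definition hi v := v.1.2.+1 * 2 ^ v.1.1.

Lemma lo_lt_hi v : lo v < hi v.
Proof. by rewrite ltn_pmul2r ?expn_gt0. Qed.

Definition leaf (j : 'I_(2 ^ k)) : cell := (ord0, j, ord0).

Lemma exp2k_gt0 : 0 < 2 ^ k. Proof. by rewrite expn_gt0. Qed.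

Definition leaf0 := leaf (Ordinal exp2k_gt0).

Lemma ancestor_subproof (j : 'I_(2 ^ k)) d : j %/ 2 ^ d < 2 ^ k.
Proof. exact: leq_ltn_trans (leq_div _ _) (ltn_ord j). Qed.

Definition ancestor j (d : 'I_k.+1) (c : 'I_n) : cell :=
  (d, Ordinal (ancestor_subproof j d), c).

Lemma ancestorE (j : 'I_(2 ^ k)) v : lo v <= j < hi v -> ancestor j v.1.1 v.2 = v.
Proof.
case: v => [[d m] c] /andP[h1 h2]; congr (_, _, _); apply: val_inj => /=.
move: h1 h2; rewrite /lo /hi /= => h1 h2; apply/eqP.
by rewrite eqn_leq -ltnS ltn_divLR ?expn_gt0 // h2 leq_divRL ?expn_gt0.
Qed.

(** Total, so no pointer is malformed: surplus codes fall back to [leaf0]. *)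
Definition decode (y : bits b) : cell := nth leaf0 (enum {: cell}) (enum_rank y).

Definition encode v : bits b := odflt [ffun=> false] [pick y | decode y == v].

Lemma encodeK : #|{: cell}| <= 2 ^ b -> cancel encode decode.
Proof.
move=> hb v; rewrite /encode; case: pickP => [y /eqP //|/(_ _)/negbT/eqP h].
have hv : index v (enum {: cell}) < #|{: bits b}|.
  rewrite card_ffun card_bool card_ord; apply: leq_trans hb.
  by rewrite cardE index_mem mem_enum.
case: (h (enum_val (Ordinal hv))).
by rewrite /decode enum_valK /= nth_index ?mem_enum.
Qed.

Definition label := {ffun 'I_k -> bool}.

(* k copies of the tree, then for each label l and copy i a sheet of n pointers. *)
Definition var := ('I_k * cell + label * 'I_k * 'I_n * 'I_b)%type.

Definition nvars := #|{: var}|.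
Implicit Types (x : bits nvars) (l : label) (i : 'I_k) (s : 'I_n).

Definition value x i v : bool := x (enum_rank (inl (i, v))).

Definition pointer x l i s : cell :=
  decode [ffun u => x (enum_rank (inr (l, i, s, u)))].

(* Stated so that pointers linked in sequence cover [0, 2^k). *)
Definition linked s v' v : bool :=
  (lo v <= if s == ord0 then 0 else hi v') && ((s == ord_max) ==> (2 ^ k <= hi v)).

(* Every block on the path from the root to the leaf designated by pointer 0 is
   all ones; check0 asks for zeros in blocks that cut all such paths. *)
Definition check1 x l i d c := value x i (ancestor (pointer x l i ord0).1.2 d c).

Definition check0 x l i s :=
  ~~ value x i (pointer x l i s) &&
  linked s (pointer x l i (inord s.-1)) (pointer x l i s).

(** One index set serves both kinds of test, the zero tests being repeated for each height, so that
    every label has exactly k (k + 1) n tests. *)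
Definition check x l (a : 'I_k * 'I_k.+1 * 'I_n) :=
  if l a.1.1 then check1 x l a.1.1 a.1.2 a.2 else check0 x l a.1.1 a.2.

Definition valid x l := [forall a, check x l a].

Definition sheet_fun : boolfun nvars := fun x => [exists l, valid x l].

(** Take the least s whose interval ends beyond j. The previous interval ends at or before j, so the
    link forces this one to begin at or before j. *)
Lemma linked_covers (f : 'I_n -> cell) (j : nat) :
  (forall s, linked s (f (inord s.-1)) (f s)) -> j < 2 ^ k ->
  exists s, lo (f s) <= j < hi (f s).
Proof.
move=> hf jk; have ex : exists s : nat, (s < n) && (j < hi (f (inord s))).
  exists n'; rewrite ltnSn /=; have /andP[_] := hf ord_max.
  rewrite eqxx /= => h; apply: leq_trans jk (leq_trans h _).
  by rewrite (_ : inord n' = ord_max) //; apply: val_inj; rewrite /= inordK.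
case: (ex_minnP ex) => s /andP[sn hs] smin; exists (inord s); rewrite hs andbT.
have /andP[h _] := hf (inord s); apply: leq_trans h _.
case: eqP => // /eqP; rewrite -val_eqE /= inordK // => s0.
rewrite leqNgt; apply/negP => h.
have := smin s.-1; rewrite h andbT (leq_ltn_trans (leq_pred s) sn) => /(_ isT).
by rewrite leqNgt prednK ?leqnn ?lt0n.
Qed.

(** The cells of a zero certificate cover the leaf j designated by a one certificate. The cell over
    j lies on the path to j, so its bit would be both 0 and 1. *)
Lemma valid_conflict x l l' i : valid x l -> valid x l' -> l i -> l' i.
Proof.
move=> /forallP hl /forallP hl' li; case E: (l' i) => //.
pose j := (pointer x l i ord0).1.2.
have h0 s : check0 x l' i s by have := hl' (i, ord0, s); rewrite /check /= E.
have [s] := @linked_covers (pointer x l' i) j (fun s => proj2 (andP (h0 s))) (ltn_ord j).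
move=> /ancestorE hs; have /andP[/negP nv _] := h0 s.
have := hl (i, (pointer x l' i s).1.1, (pointer x l' i s).2).
by rewrite /check /= li /check1 -/j hs => /nv.
Qed.

Lemma valid_unique x l l' : valid x l -> valid x l' -> l = l'.
Proof.
move=> hl hl'; apply/ffunP => i; apply/idP/idP => h.
- exact: valid_conflict hl hl' h.
- exact: valid_conflict hl' hl h.
Qed.

(** Uniqueness turns the disjunction over labels into a sum, so approximating each term separately
    costs no degree, only precision. *)
Lemma sheet_funE x : (sheet_fun x : nat) = \sum_l valid x l.
Proof.
rewrite /sheet_fun; case: existsP => [[l hl]|h].
  rewrite (bigD1 l) //= hl big1 // => l' ll'.
  by apply/eqP; rewrite eqb0; apply: contra ll' => hl'; rewrite (valid_unique hl hl').
by rewrite big1 // => l _; apply/eqP; rewrite eqb0; apply/negP => hl; case: h; exists l.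
Qed.

(** * Small cuts of the tree compatible with few known bits *)

Section Cut.
Variable T : {set cell}.

Definition inside d m := [set v | (m * 2 ^ d <= lo v) && (hi v <= m.+1 * 2 ^ d)].

(** The chaining condition of [linked] for lists of any length: gaps are forbidden but overlaps are
    not, so repeating a node is harmless. *)
Fixpoint covers (a : nat) (vs : seq cell) (e : nat) : bool :=
  if vs is v :: vs' then (lo v <= a) && covers (hi v) vs' e else e <= a.

Lemma coversW a a' vs e : a <= a' -> covers a vs e -> covers a' vs e.
Proof.
case: vs => [|v vs] aa' /=; first by move/leq_trans; apply.
by case/andP=> h ->; rewrite (leq_trans h).
Qed.

Lemma covers_cat a vs c ws e : covers a vs c -> covers c ws e -> covers a (vs ++ ws) e.
Proof.
elim: vs a => [|v vs IHvs] a /=; first exact: coversW.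
by case/andP=> -> h hw; apply: IHvs.
Qed.

(** Cells that can be 0 when T is known to agree with [null_input]: leaf blocks are 0 there already,
    and elsewhere the bit must be unknown. *)
Definition usable v := (height v == 0) || (v \notin T).

(* Every internal node all of whose n bits lie in T is split into its two children. *)
Lemma tree_cut d m : m.+1 * 2 ^ d <= 2 ^ k ->
  exists vs : seq cell, [/\ (0 < size vs)%N, all usable vs,
    covers (m * 2 ^ d) vs (m.+1 * 2 ^ d) &
    n * (size vs).-1 <= #|T :&: inside d m|].
Proof.
elim: d m => [|d IHd] m hm.
  have mk : m < 2 ^ k by rewrite muln1 in hm.
  exists [:: (ord0, Ordinal mk, ord0)]; split => //=; last by rewrite muln0.
  by rewrite /lo /hi /= !leqnn.
have mk : m < 2 ^ k by apply: leq_trans (leq_pmulr _ _) hm; rewrite expn_gt0.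
have dk : d.+1 < k.+1.
  rewrite ltnS -(@leq_exp2l 2) //; apply: leq_trans (leq_pmull _ _) hm; exact: ltn0Sn.
pose w c : cell := (Ordinal dk, Ordinal mk, c).
case: (pickP (fun c => w c \notin T)) => [c wc|hw].
  exists [:: w c]; split => //=; last by rewrite muln0.
    by rewrite /usable wc orbT.
  by rewrite /lo /hi /= !leqnn.
have e1 : m * 2 ^ d.+1 = m.*2 * 2 ^ d by rewrite expnS -muln2; lia.
have e2 : m.+1 * 2 ^ d.+1 = m.*2.+2 * 2 ^ d by rewrite expnS -muln2; lia.
have e3 : m.*2 * 2 ^ d <= m.*2.+1 * 2 ^ d by rewrite leq_mul2r leqnSn orbT.
have e4 : m.*2.+1 * 2 ^ d < m.*2.+2 * 2 ^ d by rewrite ltn_pmul2r ?expn_gt0.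
have e5 : m.*2 * 2 ^ d < m.*2.+1 * 2 ^ d by rewrite ltn_pmul2r ?expn_gt0.
have [|vs [vs0 vsT vsc vsn]] := IHd m.*2; first by rewrite e2 in hm; lia.
have [|ws [ws0 wsT wsc wsn]] := IHd m.*2.+1; first by rewrite e2 in hm.
exists (vs ++ ws); split.
- by rewrite size_cat; lia.
- by rewrite all_cat vsT.
- by rewrite e1 e2; apply: covers_cat vsc wsc.
(* The n bits of the split block all lie in T and in neither child's subtree; they pay for the one
   extra node of the joined cut. *)
pose W := w @: setT.
have cW : #|W| = n by rewrite card_imset ?cardsT ?card_ord // => c c' [].
have loW v : v \in W -> (lo v = m.*2 * 2 ^ d) * (hi v = m.*2.+2 * 2 ^ d).
  by case/imsetP=> c _ ->; rewrite /lo /hi /= -e1 -e2.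
have d1 : [disjoint T :&: inside d m.*2 & T :&: inside d m.*2.+1].
  rewrite -setI_eq0; apply/eqP/setP => v; rewrite !inE; apply/negP.
  move=> /andP[/and3P[_ _ h1] /and3P[_ h2 _]]; have := lo_lt_hi v; lia.
have d2 : [disjoint W & (T :&: inside d m.*2) :|: (T :&: inside d m.*2.+1)].
  rewrite -setI_eq0; apply/eqP/setP => v; rewrite !inE; apply/negP.
  by move=> /andP[/loW[h1 h2]]; rewrite h1 h2; lia.
have sub : W :|: ((T :&: inside d m.*2) :|: (T :&: inside d m.*2.+1))
    \subset T :&: inside d.+1 m.
  apply/subsetP => v; rewrite !inE e1 e2 => /orP[vW|].
    rewrite !loW // !leqnn !andbT; case/imsetP: vW => c _ ->.
    by have /negbFE := hw c.
  by rewrite -andb_orr => /andP[-> /=]; lia.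
apply: leq_trans (subset_leq_card sub).
move: d1 d2; rewrite -!leq_card_setU => /eqP d1 /eqP d2; rewrite d2 d1 cW size_cat.
have -> : (size vs + size ws).-1 = 1 + ((size vs).-1 + (size ws).-1) by lia.
by rewrite !mulnDr muln1 leq_add2l leq_add.
Qed.

Lemma covers_nth v0 a vs e j : covers a vs e -> j < size vs ->
  lo (nth v0 vs j) <= (if j == 0 then a else hi (nth v0 vs j.-1)) /\
  (j.+1 = size vs -> e <= hi (nth v0 vs j)).
Proof.
elim: vs a j => [|v vs IHvs] a [|j] //= /andP[h1 h2] jv.
  by split=> //; case: vs h2 {IHvs jv}.
have [h3 h4] := IHvs _ _ h2 jv; split; last by move=> [/h4].
by case: j h3 {h4 jv}.
Qed.

(** A sheet has exactly n pointers, so a shorter cut is padded by repeating its first node. *)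
Lemma covers_pad vs e r : 0 < size vs -> covers 0 vs e -> all usable vs ->
  exists vs', [/\ size vs' = r + size vs, covers 0 vs' e & all usable vs'].
Proof.
move=> vs0 h1 h2; elim: r => [|r [vs' [h3 h4 h5]]]; first by exists vs.
case: vs' h3 h4 h5 => [|v vs'] h3 /= h4 h5; first by move: h3 vs0 => /=; lia.
case/andP: h4 => h4 h4'; case/andP: h5 => h5 h5'.
exists (v :: v :: vs'); split;
  by rewrite /= ?h4 ?h4' ?h5 ?(ltnW (lo_lt_hi v)) //= addSn -h3.
Qed.

Lemma cut_pointers : #|T| < n * n -> exists f : {ffun 'I_n -> cell},
  (forall s, usable (f s)) /\ forall s, linked s (f (inord s.-1)) (f s).
Proof.
move=> hT; have [|vs [vs0 hvs cvs nvs]] := @tree_cut k 0; first by rewrite mul1n.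
rewrite mul0n mul1n in cvs.
have sn : size vs <= n.
  have : n * (size vs).-1 < n * n.
    by apply: leq_ltn_trans nvs (leq_ltn_trans _ hT); apply/subset_leq_card/subsetIl.
  by rewrite ltn_pmul2l // => h; rewrite -(prednK vs0).
have [ws [sw cw hw]] := covers_pad (n - size vs) vs0 cvs hvs.
rewrite subnK // in sw.
exists [ffun s : 'I_n => nth leaf0 ws s]; split=> s; rewrite !ffunE.
  by apply: (allP hw); rewrite mem_nth // sw.
have ssw : s < size ws by rewrite sw.
have [h1 h2] := covers_nth leaf0 cw ssw; rewrite sw in h2.
rewrite /linked inordK; last by have := ltn_ord s; lia.
apply/andP; split; first by rewrite -val_eqE.
by apply/implyP => /eqP sm; apply: h2; rewrite sm.
Qed.

End Cut.

(* Changing it to an accepted input means turning a whole leaf block to 1, or a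
   cut of the tree to 0, in each copy, and rewriting a whole sheet. *)
Definition null_var (v : var) : bool :=
  match v with inl a => height a.2 != 0 | inr a => encode leaf0 a.2 end.

Definition null_input : bits nvars := [ffun t => null_var (enum_val t)].

Lemma pointer_of (h : cell) x l i s : #|{: cell}| <= 2 ^ b ->
  (forall u, x (enum_rank (inr (l, i, s, u))) = encode h u) -> pointer x l i s = h.
Proof.
move=> hb hx; rewrite /pointer (_ : [ffun u => _] = encode h) ?encodeK //.
by apply/ffunP => u; rewrite ffunE hx.
Qed.

(** A smaller certificate of [null_input] would miss the whole sheet of some label l and, in all
    copies, the leaf block of some j; an accepted input is then built without changing any certified
    bit. *)
Lemma cert_complexity_sheet_fun : 0 < k -> #|{: cell}| <= 2 ^ b ->
  minn (2 ^ k) (n * n) <= cert_complexity sheet_fun.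
Proof.
move=> k0 hb; apply: leq_trans (leq_bigmax null_input); rewrite /cert_size.
have null_ptr l i s : pointer null_input l i s = leaf0.
  by apply: pointer_of => // u; rewrite ffunE enum_rankK.
have hnull : sheet_fun null_input = false.
  (* All pointers name [leaf0]. Its block is 0, which refutes a one certificate, and its interval
     ends at 1 < 2^k, which refutes a zero certificate. *)
  apply/existsP => -[l /forallP hl]; pose i := Ordinal k0; move: (hl (i, ord0, ord_max)).
  rewrite /check /=; case: (l i).
    by rewrite /check1 /value ffunE enum_rankK.
  rewrite /check0 null_ptr => /andP[_ /andP[_]]; rewrite eqxx.
  by rewrite /hi /= mul1n leqNgt -{1}(expn0 2) ltn_exp2l ?k0.
case: arg_minnP => [|rho hrho _]; first exact: total_assignment_certificate.
rewrite leqNgt; apply/negP => small.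
case/andP: hrho => /forallP cz /forallP hrho.
rewrite leq_min in small.
case/andP: small => small1 small2.
pose T := [set t | rho t != None].
(* Each bit of T rules out at most one label; tree bits are charged to a dummy label. The same count
   then gives j. *)
have [l hl] : exists l : label, forall t, t \in T ->
    (match enum_val t with inr a => a.1.1.1 | _ => [ffun=> false] end) != l.
  by apply: exists_notin_imset; rewrite card_ffun card_bool card_ord.
have [j hj] : exists j : 'I_(2 ^ k), forall t, t \in T ->
    (match enum_val t with inl a => a.2.1.2 | _ => Ordinal exp2k_gt0 end) != j.
  by apply: exists_notin_imset; rewrite card_ord.
have /fin_all_exists[f hf] i : exists f : {ffun 'I_n -> cell},
    (forall s, usable [set v | enum_rank (inl (i, v)) \in T] (f s)) /\
    forall s, linked s (f (inord s.-1)) (f s).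
  apply: cut_pointers; apply: leq_ltn_trans small2.
  rewrite -(card_in_imset (f := fun v => enum_rank (inl (i, v) : var))).
    by apply/subset_leq_card/subsetP => t /imsetP[v]; rewrite inE => vT ->.
  by move=> v w _ _ /enum_rank_inj[].
(* Sheet l is rewritten. Copies with [l i] true get leaf block j set to 1; the others get a 0 at
   each cell of the cut [f i]. *)
pose xv (v : var) := match v with
  | inl (i, v) => if l i then (height v != 0) || (v.1.2 == j)
                  else (height v != 0) && ~~ [exists s, f i s == v]
  | inr (l', i, s, u) => if l' == l then encode (if l i then leaf j else f i s) u
                         else encode leaf0 u
  end.
pose x : bits nvars := [ffun t => xv (enum_val t)].
have : sheet_fun x == sheet_fun null_input.
  apply: (implyP (hrho x)); apply/forallP => t; apply/implyP => tT.
  have /implyP/(_ tT)/eqP -> := cz t; apply/eqP; congr Some; rewrite !ffunE.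
  have {}tT : t \in T by rewrite inE.
  have := hj t tT; have := hl t tT.
  have {tT} : enum_rank (enum_val t) \in T by rewrite enum_valK.
  case: (enum_val t) => [[i v]|[[[l' i] s] u]] /= tT h1 h2; last by rewrite (negPf h1).
  case: (l i); first by rewrite (negPf h2) orbF.
  case E: (height v != 0) => //=; apply/esym/negP => /existsP[s /eqP fv].
  by have [/(_ s)] := hf i; rewrite /usable fv (negPf E) /= inE tT.
rewrite hnull eqbF_neg => /negP[]; apply/existsP; exists l; apply/forallP => -[[i d] c].
have ptr s : pointer x l i s = if l i then leaf j else f i s.
  by apply: pointer_of => // u; rewrite ffunE enum_rankK /= eqxx.
have val v : value x i v = xv (inl (i, v)) by rewrite /value ffunE enum_rankK.
rewrite /check /=; case: ifP => li.
  rewrite /check1 ptr li val /= li /height /=; case: (eqVneq (d : nat) 0) => //= d0.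
  by rewrite -val_eqE /= d0 divn1.
rewrite /check0 !ptr li val /= li negb_and negbK; have [_ /(_ c) -> ] := hf i.
by rewrite andbT; apply/orP; right; rewrite negbK; apply/existsP; exists c.
Qed.

End Construction.

(** * Univariate polynomials *)

Local Open Scope ring_scope.

(** * Chebyshev polynomials and the approximation of conjunctions *)

Section Chebyshev.
Variable R : realFieldType.

(* The pair (T_d, U_{d-1}), i.e. (X + sqrt (X^2 - 1))^d = T + sqrt (X^2 - 1) U. *)
Fixpoint chebTU (d : nat) : {poly R} * {poly R} :=
  if d is d'.+1 then
    let: (T, U) := chebTU d' in ('X * T + ('X^2 - 1) * U, 'X * U + T)
  else (1, 0).

Lemma chebTUS d : chebTU d.+1 =
  ('X * (chebTU d).1 + ('X^2 - 1) * (chebTU d).2, 'X * (chebTU d).2 + (chebTU d).1).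
Proof. by rewrite /=; case: (chebTU d). Qed.

Lemma size_chebTU d : (size (chebTU d).1 <= d.+1)%N && (size (chebTU d).2 <= d)%N.
Proof.
elim: d => [|d /andP[hT hU]]; first by rewrite size_poly1 size_poly0.
have hX (p : {poly R}) : (size ('X * p)%R <= (size p).+1)%N.
  by apply: leq_trans (size_polyMleq _ _) _; rewrite size_polyX.
have hX1 : (size ('X^2 - 1 : {poly R})%R <= 3)%N.
  by apply: leq_trans (size_polyD _ _) _; rewrite size_polyN size_polyXn size_poly1.
rewrite chebTUS /=; apply/andP; split; apply: leq_trans (size_polyD _ _) _;
  rewrite geq_max; apply/andP; split=> //.
- exact: leq_trans (hX _) _.
- apply: leq_trans (size_polyMleq _ _) _; lia.
- exact: leq_trans (hX _) _.
Qed.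

(** The norm T^2 - (X^2 - 1) U^2 is multiplicative, and X + sqrt (X^2 - 1) has norm 1. *)
Lemma cheb_pell d y :
  (chebTU d).1.[y] ^+ 2 + (1 - y ^+ 2) * (chebTU d).2.[y] ^+ 2 = 1.
Proof.
elim: d => [|d IHd]; first by rewrite /= hornerC horner0 expr1n expr0n mulr0 addr0.
rewrite chebTUS /= !(hornerD, hornerM, hornerX, hornerXn, hornerN, hornerC).
by rewrite -[RHS]IHd; ring.
Qed.

Lemma cheb_bounded d y : `|y| <= 1 -> `|(chebTU d).1.[y]| <= 1.
Proof.
move=> hy; have y1 : 0 <= 1 - y ^+ 2 by rewrite subr_ge0 -real_normK ?num_real// expr_le1.
rewrite -(@expr_le1 _ 2) // real_normK ?num_real// -(cheb_pell d y) lerDl.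
by rewrite mulr_ge0 ?sqr_ge0.
Qed.

(** Since U is at least d, each step of the recurrence adds at least 2 d mu to T; these increments
    sum to the quadratic term. *)
Lemma cheb_growth d mu : 0 <= mu ->
  1 + d%:R * (d%:R - 1) * mu <= (chebTU d).1.[1 + mu] /\
  d%:R <= (chebTU d).2.[1 + mu].
Proof.
move=> mu0; elim: d => [|d [hT hU]]; first by rewrite /= !hornerE; split; lra.
rewrite chebTUS /= !hornerE -natr1.
move: (_.1.[_]) (_.2.[_]) hT hU => T U hT hU.
have d0 : 0 <= d%:R :> R by [].
have T1 : 1 <= T.
  apply: le_trans hT; rewrite lerDl; case: d d0 {hU} => [|d] d0; first by rewrite !mul0r.
  by rewrite mulr_ge0 // mulr_ge0 // -natr1 addrK.
have U0 : 0 <= U by apply: le_trans hU.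
split; last by nra.
have : d%:R * mu <= U * mu by apply: ler_wpM2r.
have : 0 <= mu * T by rewrite mulr_ge0 //; lra.
have : 0 <= mu * mu * U by rewrite !mulr_ge0.
nra.
Qed.

(* Chebyshev polynomials turn the gap between 0 and [1, K] into a factor 2 at
   degree about sqrt K; a power of the result makes the error exponentially small. *)
Lemma and_polynomial (K D e : nat) : (0 < K <= D * D.-1)%N ->
  exists Q : {poly R}, [/\ (size Q <= (D * e).+1)%N, Q.[0] = 1 &
    forall m, (0 < m <= K)%N -> `|Q.[m%:R]| <= 2^-1 ^+ e].
Proof.
case/andP=> K0 KD; have K0' : 0 < K%:R :> R by rewrite ltr0n.
(* L maps 1, ..., K into [-1, 1], where T is bounded by 1, and 0 to 1 + 1/K, where K <= D (D - 1)
   makes T at least 2. *)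
pose T := (chebTU D).1; pose L : {poly R} := (1 + K%:R^-1)%:P - K%:R^-1 *: 'X.
have T2 : 2 <= T.[1 + K%:R^-1].
  have [|hT _] := @cheb_growth D K%:R^-1; first by rewrite invr_ge0 ltW.
  apply: le_trans hT.
  rewrite (_ : 2 = 1 + 1 :> R) // lerD2l ler_pdivlMr // mul1r.
  case: D KD {T} => [|D] KD; first by move: KD; rewrite leqNgt K0.
  by rewrite -natr1 addrK natr1 -natrM ler_nat.
have T0 : 0 < T.[1 + K%:R^-1] by apply: lt_le_trans T2.
exists ((T.[1 + K%:R^-1]^-1 *: (T \Po L)) ^+ e); split.
- have sL : (size L <= 2)%N.
    apply: leq_trans (size_polyD _ _) _; rewrite size_polyN geq_max.
    rewrite (leq_trans (size_polyC_leq1 _)) //=.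
    by apply: leq_trans (size_scale_leq _ _) _; rewrite size_polyX.
  have sT : (size (T \Po L) <= D.+1)%N.
    have /andP[hT _] := size_chebTU D.
    apply: leq_trans (size_comp_poly_leq _ _) _; rewrite ltnS.
    apply: leq_trans (leq_mul (_ : _ <= D)%N (_ : _ <= 1)%N) _; rewrite ?muln1 //.
      by rewrite -subn1 leq_subLR.
    by rewrite -subn1 leq_subLR.
  apply: leq_trans (size_poly_exp_leq _ _) _; rewrite ltnS leq_mul2r.
  by rewrite -subn1 leq_subLR (leq_trans (size_scale_leq _ _)) // orbT.
- rewrite horner_exp hornerZ horner_comp hornerD hornerN hornerZ hornerX hornerC.
  by rewrite mulr0 subr0 mulVf ?expr1n // gt_eqF.
- move=> m /andP[m0 mK].
  rewrite horner_exp normrX; apply: lerXn2r; rewrite ?nnegrE ?invr_ge0 //.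
  rewrite hornerZ horner_comp normrM gtr0_norm ?invr_gt0 //.
  rewrite mulrC ler_pdivrMr //.
  apply: le_trans (_ : 1 <= _); last by rewrite mulrC ler_pdivlMr //; lra.
  apply: cheb_bounded; rewrite hornerD hornerN hornerZ hornerX hornerC.
  have m1 : 1 <= m%:R :> R by rewrite ler1n.
  have mK' : m%:R <= K%:R :> R by rewrite ler_nat.
  have Ki0 : 0 < K%:R^-1 :> R by rewrite invr_gt0.
  have : K%:R^-1 * 1 <= K%:R^-1 * m%:R :> R by rewrite (ler_pM2l Ki0).
  have : K%:R^-1 * m%:R <= 1 :> R by rewrite mulrC ler_pdivrMr // mul1r.
  by rewrite ler_norml; lra.
Qed.

End Chebyshev.

(** * Finite differences and the jump of a low-degree polynomial *)

Section FiniteDifference.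
Variable R : realFieldType.

Lemma size_poly_shift_sub (n : nat) (P : {poly R}) :
  (size P <= n.+1)%N -> (size (P \Po ('X + 1) - P)%R <= n)%N.
Proof.
elim/poly_ind: P n => [|P c IHP] n.
  by rewrite comp_poly0 subrr size_poly0.
rewrite comp_poly_MXaddC size_MXaddC.
case: ifP => [/andP[/eqP -> /eqP ->] _|_ hP].
  by rewrite comp_poly0 !mul0r subrr size_poly0.
rewrite opprD addrACA subrr addr0 mulrDr mulr1 addrAC -mulrBl.
case: n hP => [|n] hP.
  move: hP; rewrite ltnS leqn0 size_poly_eq0 => /eqP ->.
  by rewrite comp_poly0 subrr mul0r addr0 size_poly0.
apply: leq_trans (size_polyD _ _) _; rewrite geq_max; apply/andP; split.
  apply: leq_trans (size_polyMleq _ _) _; rewrite size_polyX addn2 /=.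
  exact: IHP.
apply: leq_trans (size_comp_poly_leq _ _) _.
have -> : size ('X + 1 : {poly R}) = 2 by rewrite -[1]/(1%:P) size_XaddC.
by rewrite muln1; lia.
Qed.

(** By Pascal's rule the sum of order n + 1 for P is minus the sum of order n for P(X + 1) - P,
    whose degree is smaller. *)
Lemma finite_difference0 (n : nat) (P : {poly R}) : (size P <= n)%N ->
  \sum_(i < n.+1) (-1) ^+ i * 'C(n, i)%:R * P.[i%:R] = 0.
Proof.
elim: n P => [|n IHn] P hP.
  move: hP; rewrite leqn0 size_poly_eq0 => /eqP ->.
  by rewrite big1 // => i _; rewrite horner0 mulr0.
rewrite big_ord_recl /= bin0.
under eq_bigr => i _ do
  rewrite /bump /= add1n binS natrD mulrDr mulrDl.
rewrite big_split /= addrA.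
have -> : (-1) ^+ 0 * 1%:R * P.[0%:R] +
    \sum_(i < n.+1) (-1) ^+ i.+1 * 'C(n, i.+1)%:R * P.[i.+1%:R] =
    \sum_(i < n.+1) (-1) ^+ i * 'C(n, i)%:R * P.[i%:R].
  rewrite [in LHS]big_ord_recr /= bin_small // mulr0 mul0r addr0.
  by rewrite [in RHS]big_ord_recl /= bin0.
rewrite -big_split /=.
transitivity (- \sum_(i < n.+1)
    (-1) ^+ i * 'C(n, i)%:R * (P \Po ('X + 1) - P).[i%:R]); last first.
  by rewrite IHn ?oppr0 // size_poly_shift_sub.
rewrite -sumrN; apply: eq_bigr => i _.
rewrite hornerD hornerN horner_comp hornerD hornerX hornerC natr1 exprS.
by ring.
Qed.

(** This is the loss in [jump_bound]: the central binomial coefficient against the sum of all of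
    them. *)
Lemma leq_central_bin (m : nat) : (4 ^ m <= m.*2.+1 * 'C(m.*2, m))%N.
Proof.
elim: m => // m IHm; rewrite expnS.
have h1 := mul_bin_diag m.+1.*2 m; have h2 := mul_bin_down m.*2.+1 m.
move: h1 h2; rewrite doubleS /= => h1 h2.
have {}h2 : (m.*2.+1 * 'C(m.*2, m) = m.+1 * 'C(m.*2.+1, m))%N.
  by rewrite h2; congr (_ * _)%N; lia.
move: IHm h1 h2; move: (4 ^ m)%N ('C(_, _)) ('C(_, _)) ('C(_, _)) => x a b c.
by rewrite -addnn => H1 H2 H3; nia.
Qed.

(* Evaluating the 2m-th difference at the points 1 - ((i - m) / m)^2 turns
   an argument of degree < m into one of degree < 2m. *)
Lemma jump_bound (m : nat) (q : {poly R}) (delta : R) : (0 < m)%N ->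
  (size q <= m)%N ->
  (forall t, 0 <= t <= 1 - m%:R ^- 2 -> `|q.[t]| <= delta) ->
  `|q.[1]| <= m.*2.+1%:R * delta.
Proof.
move=> m0 sq hq.
have m0' : 0 < m%:R :> R by rewrite ltr0n.
pose L : {poly R} := 1 - (m%:R ^- 2) *: ('X - m%:R%:P) ^+ 2.
have LE i : L.[i] = 1 - m%:R ^- 2 * (i - m%:R) ^+ 2.
  by rewrite hornerD hornerN hornerZ horner_exp hornerD hornerN hornerX !hornerC.
have sL : (size L <= 3)%N.
  apply: leq_trans (size_polyD _ _) _; rewrite size_polyN geq_max size_poly1 /=.
  by apply: leq_trans (size_scale_leq _ _) _; rewrite size_exp_XsubC.
have sP : (size (q \Po L) <= m.*2)%N.
  apply: leq_trans (size_comp_poly_leq _ _) _.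
  have h : ((size q).-1 * (size L).-1 <= m.-1 * 2)%N by apply: leq_mul; lia.
  by apply: leq_ltn_trans h _; lia.
have mm : (m < m.*2.+1)%N by lia.
(* The central term i = m carries q(1); the other nodes fall in [0, 1 - 1/m^2], where q is small. *)
have := finite_difference0 sP; rewrite (bigD1 (Ordinal mm)) //= horner_comp LE subrr.
rewrite expr0n mulr0 subr0 => /eqP; rewrite addr_eq0 => /eqP E.
have C0 : 0 < 'C(m.*2, m)%:R :> R by rewrite ltr0n bin_gt0; lia.
have d0 : 0 <= delta.
  apply: le_trans (hq 0 _); rewrite ?normr_ge0 // lexx /= subr_ge0.
  by rewrite -exprVn expr_le1 // ?invr_ge0 // invf_le1 // ler1n.
rewrite -(ler_pM2l C0).
have {E} : 'C(m.*2, m)%:R * `|q.[1]| <= 4 ^+ m * delta.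
  have -> : 'C(m.*2, m)%:R * `|q.[1]| = `|(-1) ^+ m * 'C(m.*2, m)%:R * q.[1]|.
    by rewrite !normrM normrX normrN1 expr1n mul1r ger0_norm ?ler0n.
  rewrite E normrN; apply: le_trans (ler_norm_sum _ _ _) _.
  have -> : 4 ^+ m * delta = \sum_(i < m.*2.+1) 'C(m.*2, i)%:R * delta.
    rewrite -mulr_suml -natr_sum; congr (_ * _).
    have -> : (\sum_(i < m.*2.+1) 'C(m.*2, i) = (1 + 1) ^ m.*2)%N.
      by rewrite expnDn; apply: eq_bigr => i _; rewrite !exp1n !muln1.
    by rewrite addn1 -mul2n expnM natrX.
  rewrite [leRHS](bigD1 (Ordinal mm)) //=.
  apply: (@le_trans _ _ (\sum_(i < m.*2.+1 | i != Ordinal mm) 'C(m.*2, i)%:R * delta)).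
    apply: ler_sum => i im.
    rewrite !normrM normrX normrN1 expr1n mul1r ger0_norm ?ler0n //.
    rewrite ler_wpM2l ?ler0n // horner_comp LE; apply: hq.
    have -> : (i%:R - m%:R) ^+ 2 = (`|i - m|%N ^ 2)%:R :> R.
      by rewrite natrX natr_absz intr_norm rmorphB /= real_normK ?num_real.
    have im0 : (0 < `|i - m|)%N by move: im; rewrite -val_eqE /=; lia.
    have im1 : (`|i - m| <= m)%N by have := ltn_ord i; lia.
    rewrite mulrC lerD2l lerN2 subr_ge0 ler_pdivrMr ?exprn_gt0 // mul1r.
    rewrite -natrX ler_nat leq_exp2r // im1 /= ler_pdivlMr ?ltr0n ?expn_gt0 ?m0 //.
    by rewrite mulVf ?gt_eqF ?ltr0n ?expn_gt0 ?m0 // ler1n expn_gt0 im0.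
  by rewrite lerDr mulr_ge0 ?ler0n.
move=> h; apply: le_trans h _; rewrite mulrCA mulrA [X in _ <= X]mulrC [leLHS]mulrC.
by rewrite ler_wpM2l // -natrX -natrM ler_nat leq_central_bin.
Qed.

End FiniteDifference.

(** * Approximate degree *)

Section LowDegree.
Import mpoly.
Variables (R : realType) (N : nat).
Implicit Types (f : bits N -> R) (d : nat).

(** A property of functions on the cube rather than of polynomials, so that bounds transfer along
    any identity valid on 0/1 inputs. *)
Definition low_degree d f : Prop :=
  exists2 p : {mpoly R[N]}, (msize p <= d.+1)%N &
    forall x : bits N, p.@[fun i => (x i)%:R] = f x.

Lemma low_degree_ext d f f' : f =1 f' -> low_degree d f -> low_degree d f'.
Proof. by move=> ff' [p dp pf]; exists p => // x; rewrite pf. Qed.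

Lemma low_degreeW d d' f : (d <= d')%N -> low_degree d f -> low_degree d' f.
Proof. by move=> dd' [p dp pf]; exists p => //; apply: leq_trans dp _. Qed.

Lemma low_degree_const d c : low_degree d (fun=> c).
Proof.
exists c%:MP => [|x]; last by rewrite mevalC.
by rewrite msizeC; case: (c != 0).
Qed.

Lemma low_degree0 f : low_degree 0 f -> forall x y, f x = f y.
Proof. by move=> [p /msize1_polyC -> pf] x y; rewrite -!pf !mevalC. Qed.

Lemma low_degree_bit d i : (0 < d)%N -> low_degree d (fun x => (x i)%:R).
Proof.
move=> d0; exists 'X_i => [|x]; last by rewrite mevalXU.
by rewrite msizeX mdeg1.
Qed.

Lemma low_degreeD d f1 f2 :
  low_degree d f1 -> low_degree d f2 -> low_degree d (fun x => f1 x + f2 x).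
Proof.
move=> [p1 d1 e1] [p2 d2 e2]; exists (p1 + p2) => [|x].
  by apply: leq_trans (msizeD_le _ _) _; rewrite geq_max d1.
by rewrite mevalD e1 e2.
Qed.

Lemma low_degreeM d1 d2 f1 f2 : low_degree d1 f1 -> low_degree d2 f2 ->
  low_degree (d1 + d2) (fun x => f1 x * f2 x).
Proof.
move=> [p1 h1 e1] [p2 h2 e2]; exists (p1 * p2) => [|x]; last by rewrite mevalM e1 e2.
have [->|p10] := eqVneq p1 0; first by rewrite mul0r msize0.
have [->|p20] := eqVneq p2 0; first by rewrite mulr0 msize0.
by rewrite msizeM //; move: (msize p1) (msize p2) h1 h2 => a b; lia.
Qed.

Lemma low_degreeN d f : low_degree d f -> low_degree d (fun x => - f x).
Proof.
move=> [p dp pf]; exists (- p) => [|x]; last by rewrite mevalN pf.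
by rewrite msizeN.
Qed.

Lemma low_degree_sum (I : Type) (r : seq I) d (F : I -> bits N -> R) :
  (forall i, low_degree d (F i)) -> low_degree d (fun x => \sum_(i <- r) F i x).
Proof.
move=> hF; elim: r => [|i r IHr].
  by apply: low_degree_ext (low_degree_const d 0) => x; rewrite big_nil.
by apply: low_degree_ext (low_degreeD (hF i) IHr) => x; rewrite big_cons.
Qed.

Lemma low_degree_prod b (F : 'I_b -> bits N -> R) :
  (forall i, low_degree 1 (F i)) -> low_degree b (fun x => \prod_(i < b) F i x).
Proof.
elim: b F => [|b IHb] F hF.
  by apply: low_degree_ext (low_degree_const 0 1) => x; rewrite big_ord0.
apply: low_degree_ext (low_degreeM (hF ord0) (IHb _ (fun i => hF (lift ord0 i)))) => x.
by rewrite big_ord_recl.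
Qed.

Lemma low_degree_exp d f e : low_degree d f -> low_degree (d * e) (fun x => f x ^+ e).
Proof.
move=> hf; elim: e => [|e IHe].
  by rewrite muln0; apply: low_degree_ext (low_degree_const 0 1) => x; rewrite expr0.
by rewrite mulnS; apply: low_degree_ext (low_degreeM hf IHe) => x; rewrite exprS.
Qed.

Lemma low_degree_horner d e f (q : {poly R}) : (size q <= e.+1)%N ->
  low_degree d f -> low_degree (e * d) (fun x => q.[f x]).
Proof.
move=> sq hf.
have h i : low_degree (e * d) (fun x => q`_i * f x ^+ i).
  have [ie|ie] := leqP i e; last first.
    apply: low_degree_ext (low_degree_const _ 0) => x.
    by rewrite nth_default ?mul0r // (leq_trans sq).
  apply: low_degreeW (low_degreeM (low_degree_const 0 _) (low_degree_exp i hf)).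
  by rewrite add0n mulnC leq_mul2r ie orbT.
apply: low_degree_ext (low_degree_sum (index_enum 'I_(size q)) (fun i => h i)) => x.
by rewrite horner_coef.
Qed.

(** Interpolation: a weighted sum of the indicators of the 2^b possible readings, each a product of
    b literals. *)
Lemma low_degree_local b (v : 'I_b -> 'I_N) (F : bits b -> R) :
  low_degree b (fun x => F [ffun u => x (v u)]).
Proof.
have bit (y : bits b) u :
    low_degree 1 (fun x => if y u then (x (v u))%:R else 1 - (x (v u))%:R).
  case: (y u); first exact: low_degree_bit.
  apply: low_degreeD; first exact: low_degree_const.
  by apply: low_degreeN; apply: low_degree_bit.
have h y : low_degree b (fun x =>
    F y * \prod_u (if y u then (x (v u))%:R else 1 - (x (v u))%:R)).
  exact: (low_degreeM (low_degree_const 0 _) (low_degree_prod (bit y))).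
apply: low_degree_ext (low_degree_sum (index_enum (bits b)) h) => x.
rewrite (bigD1 [ffun u => x (v u)]) //= big1 => [|u _]; last first.
  by rewrite ffunE; case: (x _); rewrite ?subr0.
rewrite mulr1 big1 ?addr0 // => y /eqP xy.
have [u xyu] : exists u, x (v u) != y u.
  apply/existsP; apply: contra_notT xy => /existsPn xy.
  by apply/ffunP => u; rewrite ffunE; have /negPn/eqP := xy u.
rewrite (bigD1 u) //=; case: (y u) xyu; case: (x (v u)) => // _;
  by rewrite ?subrr mul0r mulr0.
Qed.

Lemma approx_degree_le (g : boolfun N) d f : low_degree d f ->
  (forall x, `|f x - (g x)%:R| <= 3^-1) -> (approx_degree R g <= d)%N.
Proof.
move=> [p dp pf] fg; apply: (@leq_trans (mpoly_degree p)); last first.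
  by rewrite /mpoly_degree -subn1 leq_subLR.
rewrite /approx_degree; case: ex_minnP => k _ /(_ (mpoly_degree p)); apply.
by apply/asboolP; exists p => // x; rewrite pf.
Qed.

Lemma approx_degreeP (g : boolfun N) : exists2 f, low_degree (approx_degree R g) f &
  forall x, `|f x - (g x)%:R| <= 3^-1.
Proof.
rewrite /approx_degree; case: ex_minnP => k /asboolP[p <- pg] _.
exists (fun x : bits N => p.@[fun i => (x i)%:R]) => //; exists p => //.
by rewrite /mpoly_degree; case: (msize p).
Qed.

(* Under a product distribution the expectation of a monomial is the product of
   the biases of its variables, whatever their exponents. *)
Lemma size_expectation d f (beta : 'I_N -> {poly R}) : low_degree d f ->
  (forall i, (size (beta i) <= 2)%N) ->
  (size (\sum_(x : bits N)
     (\prod_i (if x i then beta i else 1 - beta i)) * (f x)%:P)%R <= d.+1)%N.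
Proof.
move=> [p dp pf] sb.
pose E (m : 'X_{1..N}) : {poly R} := \prod_i (if m i == 0%N then 1 else beta i).
have sE m : (size (E m) <= (mdeg m).+1)%N.
  rewrite /E mdegE; elim/big_ind2: _ => [|n1 p1 n2 p2 h1 h2|i _].
  - by rewrite size_poly1.
  - by apply: leq_trans (size_polyMleq _ _) _; lia.
  - by case: eqP => [->|/eqP mi]; rewrite ?size_poly1 // (leq_trans (sb i)) // ltnS lt0n.
have -> : \sum_(x : bits N) (\prod_i (if x i then beta i else 1 - beta i)) * (f x)%:P =
    \sum_(m <- msupp p) p@_m *: E m.
  under eq_bigr => x _ do rewrite -pf mevalE rmorph_sum mulr_sumr.
  rewrite exchange_big /=; apply: eq_bigr => m _.
  transitivity (p@_m *: \sum_(x : bits N)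
      \prod_i ((if x i then beta i else 1 - beta i) * (x i)%:R ^+ m i)).
    rewrite scaler_sumr; apply: eq_bigr => x _.
    rewrite polyCM mulrCA mul_polyC big_split /=; congr (_ *: (_ * _)).
    rewrite rmorph_prod; apply: eq_bigr => i _.
    by case: (x i); rewrite ?expr1n // rmorphXn.
  congr (_ *: _); rewrite -(bigA_distr_bigA (fun i (b : bool) =>
    (if b then beta i else 1 - beta i) * b%:R ^+ m i)) /=.
  apply: eq_bigr => i _; rewrite big_bool /= expr1n mulr1 expr0n.
  by case: (m i == 0%N); rewrite ?mulr1 ?mulr0 ?addr0 // addrC subrK.
apply: leq_trans (size_sum _ _ _) _; apply/bigmax_leqP_seq => m mp _.
apply: leq_trans (size_scale_leq _ _) (leq_trans (sE m) _).
exact: leq_trans (msize_mdeg_lt mp) dp.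
Qed.

End LowDegree.

(** * Upper bound on the approximate degree *)

Section UpperBound.
Variables (R : realType) (k n' b : nat).
Local Notation n := n'.+1.
Implicit Types (x : bits (nvars k n' b)) (l : label k).

Lemma sum_eq_indicator (I : finType) (a : I) (F : I -> R) :
  \sum_v (a == v)%:R * F v = F a.
Proof.
rewrite (bigD1 a) //= eqxx mul1r big1 ?addr0 // => v va.
by rewrite eq_sym (negPf va) mul0r.
Qed.

Lemma low_degree_pointer l i s v :
  low_degree b (fun x => (pointer x l i s == v)%:R : R).
Proof. exact: (low_degree_local _ (fun y : bits b => (decode k n' y == v)%:R)). Qed.

(** Summing over the possible targets of the pointers replaces an indirect access by indicators; a
    test reads at most two pointers and one tree bit. *)
Lemma low_degree_check l a : low_degree (b.*2.+1) (fun x => (check x l a)%:R : R).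
Proof.
case: a => [[i d] c]; rewrite /check /=; case: (l i).
  have h v : low_degree (b + 1) (fun x =>
      (pointer x l i ord0 == v)%:R * (value x i (ancestor v.1.2 d c))%:R : R).
    by apply: low_degreeM (low_degree_pointer _ _ _ _) _; apply: low_degree_bit.
  apply: low_degreeW (low_degree_ext _ (low_degree_sum (index_enum _) h)) => [|x].
    by rewrite addn1 ltnS -addnn leq_addr.
  by rewrite sum_eq_indicator.
have h v : low_degree (b + (b + (0 + 1))) (fun x => (pointer x l i c == v)%:R *
    \sum_w (pointer x l i (inord c.-1) == w)%:R *
      ((linked c w v)%:R * (1 - (value x i v)%:R)) : R).
  apply: low_degreeM (low_degree_pointer _ _ _ _) (low_degree_sum _ _) => w.
  apply: low_degreeM (low_degree_pointer _ _ _ _) (low_degreeM _ _).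
    exact: low_degree_const.
  apply: low_degreeD; first exact: low_degree_const.
  by apply: low_degreeN; apply: low_degree_bit.
apply: low_degreeW (low_degree_ext _ (low_degree_sum (index_enum _) h)) => [|x].
  by rewrite add0n addn1 addnS addnn.
rewrite sum_eq_indicator sum_eq_indicator /check0.
by case: (value _ _ _); case: (linked _ _ _); rewrite /= ?subrr ?subr0 ?mulr0 ?mulr1.
Qed.

(** For each label the AND polynomial is applied to the number of failed tests, and the results are
    added. *)
Lemma approx_degree_sheet_fun_le (D : nat) :
  (0 < k)%N -> (k * k.+1 * n <= D * D.-1)%N ->
  (approx_degree R (sheet_fun (k := k) (n' := n') (b := b)) <= D * k.+2 * b.*2.+1)%N.
Proof.
move=> k0 hD; pose K := (k * k.+1 * n)%N.
have [|Q [sQ Q0 Qs]] := @and_polynomial R K D k.+2.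
  by rewrite hD andbT /K !muln_gt0 k0.
pose fails x l : R := \sum_a (1 - (check x l a)%:R).
have ld l : low_degree (D * k.+2 * b.*2.+1) (fun x => Q.[fails x l]).
  apply: low_degree_horner sQ _; apply: low_degree_sum => a.
  apply: low_degreeD; first exact: low_degree_const.
  by apply/low_degreeN/low_degree_check.
apply: approx_degree_le (low_degree_sum (index_enum _) ld) _ => x.
rewrite sheet_funE natr_sum -sumrB; apply: le_trans (ler_norm_sum _ _ _) _.
(* The 2^k labels contribute an error of at most 2^-(k+2) each, 1/4 in total. *)
apply: (@le_trans _ _ (\sum_(l : label k) 2^-1 ^+ k.+2)); last first.
  rewrite sumr_const card_ffun card_bool card_ord.
  rewrite -[X in X <= _]mulr_natr natrX exprVn !exprS.
  have : 2 ^+ k != 0 :> R by rewrite expf_neq0 ?pnatr_eq0.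
  by move: (2 ^+ k) => y y0; rewrite !invfM !mulrA mulfVK //; lra.
apply: ler_sum => l _.
have -> : fails x l = #|[set a | ~~ check x l a]|%:R.
  rewrite -sum1_card natr_sum big_mkcond /=; apply: eq_bigr => a _.
  by rewrite inE; case: (check _ _ _); rewrite ?subrr ?subr0.
case: (boolP (valid x l)) => [/forallP v|nv].
  rewrite (_ : [set a | _] = set0) ?cards0 ?Q0 ?subrr ?normr0 ?exprn_ge0 ?invr_ge0 //.
  by apply/setP => a; rewrite !inE v.
rewrite subr0; apply: Qs; apply/andP; split.
  have /forallPn[a ha] := nv; by rewrite card_gt0; apply/set0Pn; exists a; rewrite inE.
by apply: leq_trans (max_card _) _; rewrite !card_prod !card_ord.
Qed.

End UpperBound.

(** * Lower bound on the approximate degree from an embedded conjunction *)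

Section LowerBound.
Variables (R : realType).

(** Bernoulli gives (1 + 1/m)^m >= 2, while (1 - 1/m)^m (1 + 1/m)^m <= 1. *)
Lemma exp_one_minus_inv (m a : nat) : (0 < m)%N ->
  (1 - m%:R^-1) ^+ (m * a) <= 2^-1 ^+ a :> R.
Proof.
move=> m0; have m0' : 0 < m%:R :> R by rewrite ltr0n.
have mi1 : m%:R^-1 <= 1 :> R by rewrite invf_le1 // ler1n.
have mi0 : 0 < m%:R^-1 :> R by rewrite invr_gt0.
rewrite exprM; apply: lerXn2r; rewrite ?nnegrE ?exprn_ge0 ?subr_ge0 ?invr_ge0 //.
have bern j : 1 + j%:R * m%:R^-1 <= (1 + m%:R^-1) ^+ j :> R.
  elim: j => [|j IHj]; first by rewrite mul0r addr0.
  rewrite exprS -natr1; apply: le_trans (_ : (1 + m%:R^-1) * (1 + j%:R * m%:R^-1) <= _).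
    have : 0 <= m%:R^-1 * (j%:R * m%:R^-1) :> R by rewrite !mulr_ge0 // ltW.
    by move: (_^-1) => y; lra.
  by rewrite ler_wpM2l // addr_ge0 ?ltW.
have h2 : 2 <= (1 + m%:R^-1) ^+ m :> R.
  by have := bern m; rewrite mulfV ?gt_eqF // => h; lra.
have h1 : (1 - m%:R^-1) ^+ m * (1 + m%:R^-1) ^+ m <= 1 :> R.
  rewrite -exprMn; apply: exprn_ile1.
    by rewrite mulr_ge0 ?subr_ge0 // addr_ge0 // ltW.
  by move: (_^-1) mi0 mi1 => y; nra.
have h0 : 0 <= (1 - m%:R^-1) ^+ m :> R by rewrite exprn_ge0 ?subr_ge0.
move: (_ ^+ m) (_ ^+ m) h0 h1 h2 => y z; nra.
Qed.

Lemma third_of_1 (a : R) : `|a - 1| <= 3^-1 -> 2 / 3 <= a <= 4 / 3.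
Proof. by rewrite ler_norml => /andP[h1 h2]; apply/andP; split; lra. Qed.

Lemma third_of_1_not_0 (a : R) : `|a - 1| <= 3^-1 -> ~~ (`|a| <= 3^-1).
Proof.
move/third_of_1 => /andP[h1 _]; rewrite -ltNge; apply: lt_le_trans (ler_norm a); lra.
Qed.

Section Restriction.
Variables (N : nat) (g : boolfun N) (A : {set 'I_N}) (x1 : bits N).
Hypothesis x1A : forall t, t \in A -> x1 t.
Hypothesis gA : forall x : bits N, (forall t, t \notin A -> x t = x1 t) ->
  g x = [forall t in A, x t].

(** The random input has independent bits of bias tau on A and agrees with x1 elsewhere; x1 is the
    only accepted input in its support. *)
Let beta t : {poly R} := if t \in A then 'X else (x1 t)%:R%:P.
Let weight (tau : R) (x : bits N) : R :=
  \prod_t (if x t then (beta t).[tau] else 1 - (beta t).[tau]).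

Let betaE tau t : (beta t).[tau] = if t \in A then tau else (x1 t)%:R.
Proof. by rewrite /beta; case: ifP; rewrite ?hornerX ?hornerC. Qed.

Let weight_ge0 tau x : 0 <= tau <= 1 -> 0 <= weight tau x.
Proof.
move=> /andP[t0 t1]; apply: prodr_ge0 => t _; rewrite betaE.
by case: (t \in A); case: (x t); case: (x1 t); rewrite ?subr_ge0 ?ler01 ?subrr ?subr0.
Qed.

Let weight_sum tau : \sum_x weight tau x = 1.
Proof.
rewrite -(bigA_distr_bigA (fun t (c : bool) =>
  if c then (beta t).[tau] else 1 - (beta t).[tau])) /=.
by rewrite big1 // => t _; rewrite big_bool /= addrC subrK.
Qed.

Let weight_x1 tau : weight tau x1 = tau ^+ #|A|.
Proof.
rewrite /weight -prodr_const [RHS]big_mkcond /=; apply: eq_bigr => t _; rewrite betaE.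
by have [tA|_] := boolP (t \in A); [rewrite x1A|case: (x1 t); rewrite /= ?subr0].
Qed.

Let weight_off tau (x : bits N) : weight tau x != 0 -> forall t, t \notin A -> x t = x1 t.
Proof.
move=> /prodf_neq0 h t tA; move: (h t isT); rewrite betaE (negPf tA).
by case: (x t); case: (x1 t); rewrite ?eqxx ?subrr ?eqxx.
Qed.

Let accept_eq_x1 (x : bits N) : (forall t, t \notin A -> x t = x1 t) -> g x -> x = x1.
Proof.
move=> off; rewrite gA // => /'forall_implyP h; apply/ffunP => t.
by have [tA|/off //] := boolP (t \in A); rewrite h // x1A.
Qed.

Let g_x1 : g x1.
Proof. by rewrite gA //; apply/'forall_implyP => t; apply: x1A. Qed.

(** A constant cannot approximate g, which takes both values. Positivity later absorbs the + 1 in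
    [m]. *)
Lemma approx_degree_restriction_gt0 : (0 < #|A|)%N -> (0 < approx_degree R g)%N.
Proof.
move=> /card_gt0P[t0 t0A].
have [f ldf fg] := approx_degreeP R g; rewrite lt0n; apply/negP => /eqP d0.
pose x0 : bits N := [ffun t => (t \notin A) && x1 t].
have gx0 : g x0 = false.
  rewrite gA => [|t tA]; last by rewrite ffunE tA.
  by apply/negbTE/forallPn; exists t0; rewrite t0A ffunE t0A.
rewrite d0 in ldf; have e := low_degree0 ldf x0 x1.
have /third_of_1_not_0/negP : `|f x1 - 1| <= 3^-1 by have := fg x1; rewrite g_x1.
by apply; have := fg x0; rewrite gx0 subr0 e.
Qed.

(* A power of the approximant, averaged over i.i.d. bits of bias tau on A, is a
   polynomial in tau of size at most m which is tiny for tau <= 1 - 1/m^2 but not at 1. *)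
Lemma approx_degree_restriction e (m := (approx_degree R g * e).+1) :
  (#|A| < m ^ 2 * e.*2)%N \/ (2 ^ e <= m.*2.+1.*2)%N.
Proof.
have [|An] := ltnP; first by left.
right; have [f ldf fg] := approx_degreeP R g.
have ldF := low_degree_exp e ldf.
pose q : {poly R} := \sum_(x : bits N)
  (\prod_t (if x t then beta t else 1 - beta t)) * (f x ^+ e)%:P.
have sq : (size q <= m)%N.
  apply: size_expectation ldF _ => t; rewrite /beta; case: ifP => _.
    by rewrite size_polyX.
  exact: leq_trans (size_polyC_leq1 _) _.
have qE tau : q.[tau] = \sum_x weight tau x * f x ^+ e.
  rewrite horner_sum; apply: eq_bigr => x _; rewrite hornerM hornerC horner_prod.
  congr (_ * _); apply: eq_bigr => t _; case: (x t) => //.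
  by rewrite hornerD hornerN hornerC.
have f0 x : ~~ g x -> `|f x ^+ e| <= 3^-1 ^+ e.
  move=> /negbTE gx; rewrite normrX; apply: lerXn2r; rewrite ?nnegrE ?invr_ge0 //.
  by have := fg x; rewrite gx subr0.
have f1 : (2 / 3) ^+ e <= `|f x1 ^+ e| <= (4 / 3) ^+ e.
  have /third_of_1/andP[h1 h2] : `|f x1 - 1| <= 3^-1 by have := fg x1; rewrite g_x1.
  have h3 : 0 <= 2 / 3 :> R by rewrite divr_ge0.
  have h4 : 0 <= f x1 := le_trans h3 h1.
  rewrite ger0_norm ?exprn_ge0 //; apply/andP; split; apply: lerXn2r;
    by rewrite ?nnegrE // (le_trans h4 h2).
case/andP: f1 => f1l f1u.
(* At tau = 1 all the mass sits on x1, so q(1) is the e-th power of f(x1). *)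
have q1 : (2 / 3) ^+ e <= `|q.[1]|.
  rewrite qE (bigD1 x1) //= weight_x1 expr1n mul1r big1 ?addr0 // => x xx1.
  have := weight_sum 1; rewrite (bigD1 x1) //= weight_x1 expr1n => /eqP.
  rewrite addrC -subr_eq0 addrK psumr_eq0 => [/allP/(_ x)|y _]; last first.
    by rewrite weight_ge0 // ler01 lexx.
  by rewrite mem_index_enum xx1 => /(_ isT)/eqP ->; rewrite mul0r.
have m0 : 0 < m%:R :> R by rewrite ltr0n.
(* As |A| >= 2 e m^2, the input x1 has probability at most 4^-e, which offsets the bound (4/3)^e on
   its term; the rejected inputs contribute at most 3^-e. *)
have qt t : 0 <= t <= 1 - m%:R ^- 2 -> `|q.[t]| <= 2 * 3^-1 ^+ e.
  move=> /andP[t0 t1]; have t01 : 0 <= t <= 1.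
    by rewrite t0 (le_trans t1) // gerBl invr_ge0 exprn_ge0 // ltW.
  rewrite qE (bigD1 x1) //=.
  rewrite (_ : 2 * _ = 3^-1 ^+ e + 3^-1 ^+ e); last by rewrite mulrDl mul1r.
  apply: le_trans (ler_normD _ _) (lerD _ _).
    rewrite normrM weight_x1 ger0_norm ?exprn_ge0 //.
    have -> : 3^-1 ^+ e = 4^-1 ^+ e * (4 / 3) ^+ e :> R.
      by rewrite -exprMn mulrA mulVf ?mul1r // pnatr_eq0.
    apply: ler_pM => //; first exact: exprn_ge0.
    apply: le_trans (_ : (1 - m%:R ^- 2) ^+ (m ^ 2 * e.*2) <= _).
      have u0 : 0 <= 1 - m%:R ^- 2 :> R by apply: le_trans t1.
      apply: (@le_trans _ _ ((1 - m%:R ^- 2) ^+ #|A|)).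
        by apply: lerXn2r; rewrite ?nnegrE.
      by apply: ler_wiXn2l => //; rewrite gerBl invr_ge0 exprn_ge0 // ltW.
    rewrite -natrX; apply: le_trans (exp_one_minus_inv _ _) _; first by rewrite expn_gt0.
    by rewrite -mul2n exprM exprVn -natrX.
  apply: le_trans (ler_norm_sum _ _ _) _.
  apply: (@le_trans _ _ (\sum_(x | x != x1) weight t x * 3^-1 ^+ e)).
    apply: ler_sum => x xx1; rewrite normrM ger0_norm ?weight_ge0 //.
    have [->|w0] := eqVneq (weight t x) 0; first by rewrite !mul0r.
    apply: ler_wpM2l; first exact: weight_ge0.
    by apply: f0; apply: contra xx1 => gx; rewrite (accept_eq_x1 (weight_off w0) gx).
  rewrite -mulr_suml ler_piMl ?exprn_ge0 ?invr_ge0 //.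
  by rewrite -(weight_sum t) [leRHS](bigD1 x1) //= lerDr weight_ge0.
(* Multiplying (2/3)^e <= (2m + 1) 2 3^-e by 3^e leaves the second alternative. *)
have := jump_bound (ltn0Sn _) sq qt; move=> /(le_trans q1).
rewrite exprMn mulrA ler_pM2r ?exprn_gt0 ?invr_gt0 //.
by rewrite -natrX -natrM ler_nat muln2.
Qed.

End Restriction.
End LowerBound.

Section LowerBoundSheet.
Variables (R : realType) (k n' b : nat).
Local Notation n := n'.+1.
Hypotheses (k0 : (0 < k)%N) (hb : (#|{: cell k n'}| <= 2 ^ b)%N).

(* Fixing all other bits so that only the label (1, ..., 1) can be valid leaves
   the conjunction of the n bits of one root block. *)
Let root (c : 'I_n) : cell k n' := (ord_max, Ordinal (exp2k_gt0 k), c).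
Let root_bit (c : 'I_n) : 'I_(nvars k n' b) := enum_rank (inl (Ordinal k0, root c)).

Let ones_var (v : var k n' b) : bool :=
  if v is inr a then encode b (leaf0 k n') a.2 else true.

Let roots : {set 'I_(nvars k n' b)} := [set root_bit c | c : 'I_n].
Let ones : bits (nvars k n' b) := [ffun t => ones_var (enum_val t)].

Let card_roots : #|roots| = n.
Proof. by rewrite card_imset ?card_ord // => c c' /enum_rank_inj[]. Qed.

Let ones_roots t : t \in roots -> ones t.
Proof. by case/imsetP=> c _ ->; rewrite ffunE enum_rankK. Qed.

(** All pointers name [leaf0], so no zero certificate reaches 2^k; a one certificate follows the
    path to leaf 0, where only the chosen root bits are free. *)
Let sheet_fun_roots (x : bits (nvars k n' b)) :
  (forall t, t \notin roots -> x t = ones t) ->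
  sheet_fun x = [forall t in roots, x t].
Proof.
move=> off.
have ptr l i s : pointer x l i s = leaf0 k n'.
  apply: pointer_of => // u; rewrite off ?ffunE ?enum_rankK //.
  by apply/negP => /imsetP[c _ /enum_rank_inj].
have val i v : enum_rank (inl (i, v)) \notin roots -> value x i v.
  by move=> /off h; rewrite /value h ffunE enum_rankK.
apply/existsP/'forall_implyP => [[l /forallP hl] t|h].
  case/imsetP=> c _ ->; pose i := Ordinal k0.
  case E: (l i).
    have := hl (i, ord_max, c); rewrite /check E /check1 ptr /value.
    congr (is_true (x (enum_rank (inl (_, _))))).
    by rewrite /ancestor /root; congr (_, _, _); apply: val_inj; rewrite /= div0n.
  have := hl (i, ord0, ord_max); rewrite /check E /check0 ptr => /andP[_ /andP[_]].
  by rewrite eqxx /hi /= mul1n leqNgt -{1}(expn0 2) ltn_exp2l ?k0.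
exists [ffun=> true]; apply/forallP => -[[i d] c]; rewrite /check ffunE /check1 /=.
set v := ancestor _ d c.
by have [hv|/val //] := boolP (enum_rank (inl (i, v)) \in roots); apply: h.
Qed.

Lemma approx_degree_sheet_fun_gt0 :
  (0 < approx_degree R (sheet_fun (k := k) (n' := n') (b := b)))%N.
Proof.
by apply: approx_degree_restriction_gt0 ones_roots sheet_fun_roots _; rewrite card_roots.
Qed.

Lemma approx_degree_sheet_fun_ge e
    (m := (approx_degree R (sheet_fun (k := k) (n' := n') (b := b)) * e).+1) :
  (n < m ^ 2 * e.*2)%N \/ (2 ^ e <= m.*2.+1.*2)%N.
Proof.
by have := approx_degree_restriction R ones_roots sheet_fun_roots e; rewrite card_roots.
Qed.

End LowerBoundSheet.

(** * Asymptotics *)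

From mathcomp Require Import classical_sets cardinality topology.
From mathcomp Require Import normedtype landau sequences exp.
Import numFieldNormedType.Exports.
Local Open Scope classical_set_scope.
Local Open Scope ring_scope.

Section Sizes.
Local Open Scope nat_scope.

(** Here n = 2^q: height 2 q gives n^2 leaves and n^2 labels, and 6 q bits can address all (2 q + 1)
    n^3 cells. *)
Definition sheet_nvars q := nvars q.*2 (2 ^ q).-1 (6 * q).

Definition sheet q : boolfun (sheet_nvars q) :=
  sheet_fun (k := q.*2) (n' := (2 ^ q).-1) (b := 6 * q).

Let pred2q q : (2 ^ q).-1.+1 = 2 ^ q.
Proof. by rewrite prednK ?expn_gt0. Qed.

Let exp2double q : 2 ^ q.*2 = (2 ^ q) ^ 2.
Proof. by rewrite -muln2 expnM. Qed.

Lemma sheet_nvarsE q : sheet_nvars q = (q.*2 * (8 * q).+1) * (2 ^ q) ^ 3.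
Proof.
rewrite /sheet_nvars /nvars card_sum !card_prod !card_ord card_ffun card_bool card_ord.
by rewrite pred2q exp2double; move: (2 ^ q) => y; rewrite -muln2; ring.
Qed.

Lemma card_sheet_cell q : #|{: cell q.*2 (2 ^ q).-1}| <= 2 ^ (6 * q).
Proof.
rewrite !card_prod !card_ord pred2q (_ : 6 * q = q.*2 + q.*2 + q.*2); last by lia.
rewrite !expnD; apply: leq_mul; last by rewrite leq_exp2l //; lia.
by apply: leq_mul => //; apply: ltn_expl.
Qed.

Lemma cert_complexity_sheet_ge q : 0 < q -> (2 ^ q) ^ 2 <= cert_complexity (@sheet q).
Proof.
move=> q0; apply: leq_trans (cert_complexity_sheet_fun _ (card_sheet_cell q)).
  by rewrite pred2q exp2double mulnn minnn.
by rewrite double_gt0.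
Qed.

(** Squared to stay in [nat] for odd q; [h] is 2^(q/2) rounded up to a power of two. *)
Lemma approx_degree_sheet_le (R : realType) q : 0 < q ->
  approx_degree R (@sheet q) ^ 2 <= (624 * q ^ 3) ^ 2 * 2 ^ q.
Proof.
move=> q0; pose h := 2 ^ uphalf q.
have h0 : 0 < h by rewrite expn_gt0.
have hq := odd_double_half q; have hq' := uphalf_half q.
have hl : 2 ^ q <= h * h by rewrite -expnD leq_exp2l //; lia.
have hu : h * h <= 2 * 2 ^ q by rewrite -expnD -expnS leq_exp2l //; lia.
pose D := (q.*2.+1 * h).+1.
have hD : q.*2 * q.*2.+1 * (2 ^ q).-1.+1 <= D * D.-1.
  rewrite pred2q /D /=; move: (2 ^ q) hl => y hl.
  apply: (@leq_trans (q.*2.+1 * q.*2.+1 * (h * h))); last first.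
    by rewrite mulnACA leq_mul2r leqnSn orbT.
  by apply: leq_mul => //; rewrite leq_mul2r leqnSn orbT.
have k0 : 0 < q.*2 by rewrite double_gt0.
have hd := approx_degree_sheet_fun_le R (6 * q) k0 hD.
have {}hd : approx_degree R (@sheet q) <= 312 * q ^ 3 * h.
  apply: leq_trans hd _.
  (* The three factors bound D, k + 2 = 2 q + 2 and 2 b + 1 = 12 q + 1. *)
  have -> : 312 * q ^ 3 * h = (6 * q * h) * (4 * q) * (13 * q) by ring.
  have hD' : D <= 6 * q * h.
    apply: (@leq_trans (q.*2.+2 * h)); first by rewrite /D [in leqRHS]mulSn -add1n leq_add2r.
    by rewrite leq_mul2r; apply/orP; right; lia.
  by apply: leq_mul; [apply: leq_mul => //; lia | lia].
have : approx_degree R (@sheet q) ^ 2 <= (312 * q ^ 3 * h) ^ 2 by rewrite leq_exp2r.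
move/leq_trans; apply; move: (q ^ 3) (2 ^ q) hu => u y hu.
have -> : (312 * u * h) ^ 2 = 312 ^ 2 * u ^ 2 * (h * h) by ring.
have -> : (624 * u) ^ 2 * y = 312 ^ 2 * u ^ 2 * (4 * y) by ring.
by rewrite leq_mul2l (leq_trans hu) ?orbT // leq_mul2r orbT.
Qed.

Lemma approx_degree_sheet_gt0 (R : realType) q : 0 < q -> 0 < approx_degree R (@sheet q).
Proof.
by move=> q0; apply: approx_degree_sheet_fun_gt0 (card_sheet_cell q); rewrite double_gt0.
Qed.

Lemma approx_degree_sheet_ge (R : realType) q : 0 < q ->
  2 ^ q <= (48 * q ^ 2 * approx_degree R (@sheet q)) ^ 2.
Proof.
move=> q0; have k0 : 0 < q.*2 by rewrite double_gt0.
have := approx_degree_sheet_fun_ge R k0 (card_sheet_cell q) q.+3.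
rewrite pred2q -/(sheet (q := q)); have := approx_degree_sheet_gt0 R q0.
move: (approx_degree _ _) => d d0 h.
(* With e = q + 3 the second alternative already gives 2^q <= m, so both yield the bound of the
   first in weak form. *)
pose e := q.+3; have {}h : 2 ^ q <= (d * e).+1 ^ 2 * e.*2.
  case: h => [/ltnW //|]; rewrite !expnS -/e; move: (2 ^ q) (d * e) => y m h.
  have ym : y <= m.+1 by lia.
  by apply: leq_trans ym _; rewrite expn0 muln1 -mulnA leq_pmulr // muln_gt0 double_gt0.
apply: leq_trans h _.
have : (d * e).+1 ^ 2 * e.*2 <= (2 * (d * e)) ^ 2 * (2 * e).
  apply: leq_mul; last by rewrite mul2n.
  by rewrite leq_exp2r // mul2n -addnn -addn1 leq_add2l muln_gt0 d0.
move/leq_trans; apply.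
have e4 : e <= 4 * q by rewrite /e; lia.
have : (2 * (d * e)) ^ 2 * (2 * e) <= (2 * (d * (4 * q))) ^ 2 * (2 * (4 * q)).
  by apply: leq_mul; rewrite ?leq_exp2r ?leq_mul2l ?e4 ?orbT.
move/leq_trans; apply.
have -> : (2 * (d * (4 * q))) ^ 2 * (2 * (4 * q)) = 512 * (d ^ 2 * q ^ 3) by ring.
have -> : (48 * q ^ 2 * d) ^ 2 = 2304 * (d ^ 2 * q ^ 4) by ring.
by apply: leq_mul => //; rewrite leq_mul2l leq_pexp2l ?orbT.
Qed.

End Sizes.

Section Asymptotics.
Variable R : realType.

(** Starting at 2 keeps the height 2 q of the trees positive. *)
Definition powers_of_two : set nat := range (fun q => 2 ^ q.+1)%N.

Lemma infinite_powers_of_two : infinite_set powers_of_two.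
Proof.
move=> fin; apply: infinite_nat.
have := finite_preimage (f := fun q => 2 ^ q.+1)%N _ fin.
rewrite (_ : _ @^-1` _ = setT); last by apply/seteqP; split=> // q _; exists q.
by apply=> p q _ _ /eqP; rewrite eqn_exp2l // eqSS => /eqP.
Qed.

Let F : set_system nat := within powers_of_two \oo.

Lemma near_powers_of_two (P : nat -> Prop) :
  (forall q, (0 < q)%N -> P (2 ^ q)%N) -> \forall n \near F, P n.
Proof.
move=> h; suff : \forall n \near \oo, powers_of_two n -> P n by [].
by apply: filterE => n [q _ <-]; apply: (h q.+1).
Qed.

Let ln2_gt0 : 0 < ln (2 : R).
Proof. by apply: ln_gt0; rewrite ltr1n. Qed.

Let ln_pow2 (q j : nat) :
  (ln ((2 ^ q)%N%:R : R)) `^ j%:R = q%:R ^+ j * ln 2 ^+ j.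
Proof.
by rewrite natrX lnXn // powR_mulrn ?mulrn_wge0 ?ltW // -[ln 2 *+ q]mulr_natl exprMn.
Qed.

(** At n = 2^q, ln n = q ln 2, so a factor q^j is a power of ln n up to the constant (ln 2)^j. *)
Lemma soft_O_powers (a b : nat -> R) (K : R) (j : nat) : 0 < K -> (0 < j)%N ->
  (forall q, (0 < q)%N -> a (2 ^ q)%N <= K * q%:R ^+ j * b (2 ^ q)%N) -> soft_O F a b.
Proof.
move=> K0 j0 h; exists (K / ln 2 ^+ j), j%:R; split.
- by rewrite divr_gt0 ?exprn_gt0.
- by rewrite ltr0n.
apply: near_powers_of_two => q q0; apply: le_trans (h q q0) _.
have l0 : ln 2 ^+ j != 0 :> R by rewrite expf_neq0 ?gt_eqF.
by rewrite ln_pow2 le_eqVlt; apply/orP; left; apply/eqP; field.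
Qed.

Lemma soft_Omega_powers (a b : nat -> R) (K : R) (j : nat) : 0 < K -> (0 < j)%N ->
  (forall q, (0 < q)%N -> b (2 ^ q)%N <= K * q%:R ^+ j * a (2 ^ q)%N) -> soft_Omega F a b.
Proof.
move=> K0 j0 h; exists (ln 2 ^+ j / K), j%:R; split.
- by rewrite divr_gt0 ?exprn_gt0.
- by rewrite ltr0n.
apply: near_powers_of_two => q q0; rewrite ln_pow2.
have l0 : ln 2 ^+ j != 0 :> R by rewrite expf_neq0 ?gt_eqF.
have q0' : 0 < K * q%:R ^+ j by rewrite mulr_gt0 ?exprn_gt0 ?ltr0n.
have qj0 : q%:R ^+ j != 0 :> R by rewrite expf_neq0 // pnatr_eq0 -lt0n.
have Kn : K != 0 by rewrite gt_eqF.
have -> : ln 2 ^+ j / K * b (2 ^ q)%N / (q%:R ^+ j * ln 2 ^+ j) =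
    b (2 ^ q)%N / (K * q%:R ^+ j) by field; rewrite Kn qj0 l0.
by rewrite ler_pdivrMr // mulrC h.
Qed.

End Asymptotics.

Theorem theorem1p1 (R : realType) :
  exists NN : set nat,
    [/\ infinite_set NN, (forall n, NN n -> (0 < n)%N) &
      exists (N : nat -> nat) (G : forall n, boolfun (N n)),
        let F := within NN \oo in
        let C (n : nat) : R := (cert_complexity (G n))%:R in
        let adeg (n : nat) : R := (approx_degree R (G n))%:R in
        [/\ soft_Theta F (fun n => (N n)%:R : R) (fun n => n%:R ^+ 3),
            C =Omega_F (fun n => n%:R ^+ 2 : R),
            soft_Theta F adeg (fun n => Num.sqrt n%:R) &
            soft_Omega F C (fun n => adeg n ^+ 4)]].
Proof.
exists powers_of_two; split.
- exact: infinite_powers_of_two.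
- by move=> n [q _ <-]; rewrite expn_gt0.
(* [trunc_log] recovers q from n = 2^q; its values at other n are irrelevant to the limit within
   [powers_of_two]. *)
exists (fun n => sheet_nvars (trunc_log 2 n)), (fun n => @sheet (trunc_log 2 n)).
move=> F C adeg.
have Cge q : (0 < q)%N -> (2 ^ q)%N%:R ^+ 2 <= C (2 ^ q)%N.
  by move=> q0; rewrite /C trunc_expnK // -natrX ler_nat cert_complexity_sheet_ge.
have ale q : (0 < q)%N -> adeg (2 ^ q)%N ^+ 2 <= (624 * q%:R ^+ 3) ^+ 2 * (2 ^ q)%N%:R.
  move=> q0; rewrite /adeg trunc_expnK // -!natrX -natrM -natrX -natrM ler_nat.
  exact: approx_degree_sheet_le.
have age q : (0 < q)%N -> (2 ^ q)%N%:R <= (48 * q%:R ^+ 2 * adeg (2 ^ q)%N) ^+ 2.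
  move=> q0; rewrite /adeg trunc_expnK // -!natrX -!natrM -natrX ler_nat.
  exact: approx_degree_sheet_ge.
split.
- split.
    apply: (@soft_O_powers _ _ _ 18 2) => // q q0.
    rewrite trunc_expnK // sheet_nvarsE -!natrX -!natrM ler_nat leq_mul2r.
    apply/orP; right.
    rewrite (_ : (18 * q ^ 2 = q.*2 * (9 * q))%N); last by rewrite -muln2; ring.
    by rewrite leq_mul2l; apply/orP; right; lia.
  apply: (@soft_Omega_powers _ _ _ 1 1) => // q q0.
  rewrite trunc_expnK // sheet_nvarsE expr1 mul1r -!natrX -!natrM ler_nat.
  by rewrite mulnA leq_pmull // !muln_gt0 double_gt0 q0.
- rewrite eqOmegaE qualifE; apply/asboolP; exists 1 => //.
  apply: near_powers_of_two => q q0.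
  by rewrite mul1r ger0_norm ?exprn_ge0 // ger0_norm ?Cge // /C.
- split.
    apply: (@soft_O_powers _ _ _ 624 3) => // q q0.
    have c0 : 0 <= 624 * q%:R ^+ 3 :> R by rewrite mulr_ge0 // exprn_ge0.
    rewrite -[leLHS]ger0_norm; last by rewrite /adeg.
    rewrite -sqrtr_sqr -[X in X * _]ger0_norm // -sqrtr_sqr -sqrtrM ?sqr_ge0 //.
    by rewrite ler_wsqrtr // ale.
  apply: (@soft_Omega_powers _ _ _ 48 2) => // q q0.
  have c0 : 0 <= 48 * q%:R ^+ 2 * adeg (2 ^ q)%N by rewrite !mulr_ge0 // exprn_ge0.
  by rewrite -[leRHS]ger0_norm // -sqrtr_sqr ler_wsqrtr // age.
(* Squaring the bound on the squared degree gives (624 q^3)^4 n^2, and n^2 is at most the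
   certificate complexity. *)
- apply: (@soft_Omega_powers _ _ _ (624 ^+ 4) 12) => [||q q0]; rewrite ?exprn_gt0 //.
  have h := ale q q0; rewrite (_ : 4%N = (2 * 2)%N) // exprM.
  apply: le_trans (_ : ((624 * q%:R ^+ 3) ^+ 2 * (2 ^ q)%N%:R) ^+ 2 <= _).
    by apply: lerXn2r; rewrite ?nnegrE ?sqr_ge0 // (le_trans _ h) ?sqr_ge0.
  have -> : ((624 * q%:R ^+ 3) ^+ 2 * (2 ^ q)%N%:R) ^+ 2 =
    624 ^+ 4 * q%:R ^+ 12 * (2 ^ q)%N%:R ^+ 2 :> R by ring.
  by apply: ler_wpM2l; rewrite ?Cge // mulr_ge0 ?exprn_ge0.
Qed.
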